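(* Let $w$ be a primitive word over $V$. Then $w$ is not ins-robust if and only if $w$ can be written as $w = u^{r} u_1 u_2 u^{s}$, where $u_1, u_2 \in V^*$, $c \in V$, $u = u_1 c u_2 \in Q$, $r, s \ge 0$ are integers and $r + s \ge 1$.
   Context: $V$ is a finite alphabet with at least two distinct letters; $V^*$ is the set of all finite words over $V$ (including the empty word $\lambda$), and $|w|$ denotes the length of $w$. A nonempty word $w$ is primitive if it is not of the form $v^n$ for a word $v$ and an integer $n \ge 2$; $Q$ denotes the set of primitive words over $V$. For a word $w$ of length $n$, $w[1..i]$ denotes its prefix of length $i$ (empty for $i=0$) and $w[i+1..n]$ its suffix of length $n-i$. A primitive word $w$ of length $n$ is called ins-robust if for every $i \in \{0,1,\ldots,n\}$ and every $a \in V$ the word $w[1..i]\,a\,w[i+1..n]$ is primitive. *)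

(* Defs.v *)
From mathcomp Require Import all_boot.

Set Implicit Arguments.
Unset Strict Implicit.
Unset Printing Implicit Defensive.

Definition word_pow (V : Type) (v : seq V) (n : nat) : seq V :=
  flatten (nseq n v).

Definition primitive_word (V : Type) (w : seq V) : Prop :=
  w <> [::] /\ ~ (exists (v : seq V) (n : nat), 2 <= n /\ w = word_pow v n).

(* [i] counts the letters before the insertion point, so both ends,
   [i = 0] and [i = size w], are allowed. *)
Definition ins_robust (V : Type) (w : seq V) : Prop :=
  primitive_word w /\
  forall (i : nat) (a : V), i <= size w ->
    primitive_word (take i w ++ a :: drop i w).

(* Main.v *)
Require Import Defs.
From mathcomp Require Import all_boot.
From Stdlib Require Import Classical.

(** If inserting [a] into [w] produces a proper power, that power is [u ^ n]
    with [u] primitive and [n >= 2].  The letter [a] falls inside one of the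
    [n] copies of [u]; removing it leaves [u ^ r u1 u2 u ^ s] with
    [r + s = n - 1 >= 1].  Conversely, putting [c] back into such a word
    restores [u ^ (r + s + 1)]. *)

Section WordPowers.

Set Implicit Arguments.
Unset Strict Implicit.

Variable V : Type.
Implicit Types (u v w x y : seq V) (m n : nat).

Lemma word_powS v n : word_pow v n.+1 = v ++ word_pow v n.
Proof. by []. Qed.

Lemma word_powD v m n : word_pow v (m + n) = word_pow v m ++ word_pow v n.
Proof. by rewrite /word_pow nseqD flatten_cat. Qed.

Lemma word_powM v m n : word_pow v (m * n) = word_pow (word_pow v m) n.
Proof. by elim: n => [|n IHn]; rewrite ?muln0 // mulnS word_powD IHn. Qed.

Lemma word_pow1 v : word_pow v 1 = v.
Proof. exact: cats0. Qed.

Lemma word_pow_nil n : word_pow [::] n = [::] :> seq V.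
Proof. by elim: n. Qed.

Lemma size_word_pow v n : size (word_pow v n) = n * size v.
Proof. by rewrite /word_pow size_flatten /shape map_nseq sumn_nseq mulnC. Qed.

(** Strong induction on length: when [w] is a proper power, its base is nonempty and strictly
    shorter, and nested exponents multiply. *)
Lemma primitive_root_exists w :
  w <> [::] ->
  exists u m, [/\ primitive_word u, 0 < m & w = word_pow u m].
Proof.
have [k] := ubnP (size w); elim: k w => // k IHk w lt_wk w_nil.
case: (classic (primitive_word w)) => [w_prim | w_nprim].
  by exists w, 1; rewrite word_pow1.
have [v [n [n_gt1 def_w]]] :
    exists v n, 2 <= n /\ w = word_pow v n.
  by apply: NNPP => no_pow; apply: w_nprim.
have v_nil : v <> [::] by move=> v0; apply: w_nil; rewrite def_w v0 word_pow_nil.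
have v_gt0 : 0 < size v by case: (v) v_nil.
have lt_vw : size v < size w by rewrite def_w size_word_pow ltn_Pmull.
have [u [m [u_prim m_gt0 def_v]]] := IHk v (leq_trans lt_vw lt_wk) v_nil.
exists u, (m * n); split=> //; first by rewrite muln_gt0 m_gt0 ltnW.
by rewrite word_powM -def_v.
Qed.

(** Copies of [u] are peeled off the front until the one containing the marked [a] is reached; [r]
    counts the copies before it, [s] those after. *)
Lemma word_pow_split_letter u n x a y :
  x ++ a :: y = word_pow u n ->
  exists r s u1 u2,
    [/\ u = u1 ++ a :: u2, n = (r + s).+1,
        x = word_pow u r ++ u1 & y = u2 ++ word_pow u s].
Proof.
elim: n x => [[]//|n IHn] x; rewrite word_powS => def_xy.
(* If the sizes are equal, [a] opens the next copy, so this case belongs to the recursive branch. *)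
have [lt_xu | le_ux] := ltnP (size x) (size u).
- have def_x : x = take (size x) u.
    by rewrite -[RHS](takel_cat (word_pow u n) (ltnW lt_xu)) -def_xy take_size_cat.
  have : a :: y = drop (size x) u ++ word_pow u n.
    by have := congr1 (drop (size x)) def_xy; rewrite drop_size_cat // drop_cat lt_xu.
  (* What remains of the first copy after [x] is nonempty, so its head must be [a]. *)
  have : 0 < size (drop (size x) u) by rewrite size_drop subn_gt0.
  case def_u2: (drop (size x) u) => [//|b u2] _ [def_a def_y].
  exists 0, n, x, u2; split=> //.
  by rewrite {1}def_x def_a -def_u2 cat_take_drop.
- have def_u : u = take (size u) x.
    by rewrite -[RHS](takel_cat (a :: y) le_ux) def_xy take_size_cat.
  have def_x : x = u ++ drop (size u) x by rewrite {1}def_u cat_take_drop.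
  have /IHn[r [s [u1 [u2 [def_u12 -> def_x' ->]]]]] :
      drop (size u) x ++ a :: y = word_pow u n.
    have := congr1 (drop (size u)) def_xy.
    by rewrite {1}def_x -catA !drop_size_cat.
  by exists r.+1, s, u1, u2; split=> //; rewrite word_powS -catA -def_x'.
Qed.

End WordPowers.

Theorem theorem4 (V : finType) (hV : 2 <= #|V|) (w : seq V)
    (hw : primitive_word w) :
  ~ ins_robust w <->
  exists (u u1 u2 : seq V) (c : V) (r s : nat),
    [/\ u = u1 ++ c :: u2, primitive_word u, 1 <= r + s
      & w = word_pow u r ++ u1 ++ u2 ++ word_pow u s].
Proof.
split=> [not_robust | [u [u1 [u2 [c [r [s [def_u _ rs_gt0 def_w]]]]]]] [_ robust]].
- apply: NNPP => no_decomp; apply: not_robust; split=> // i a le_iw.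
  split=> [|[v [n [n_gt1 def_vn]]]]; first by case: (take i w).
  have v_nil : v <> [::].
    by move=> v0; move: def_vn; rewrite v0 word_pow_nil; case: (take i w).
  (* The base [v] may itself be a power; its primitive root [u] gives exponent [m * n]. *)
  have [u [m [u_prim m_gt0 def_v]]] := primitive_root_exists v_nil.
  rewrite def_v -word_powM in def_vn.
  have [r [s [u1 [u2 [def_u def_mn def_x def_y]]]]] := word_pow_split_letter def_vn.
  apply: no_decomp; exists u, u1, u2, a, r, s; split=> //.
    (* [(r + s).+1 = m * n >= n >= 2]. *)
    by rewrite -ltnS -def_mn (leq_trans n_gt1) // leq_pmull.
  by rewrite -(cat_take_drop i w) def_x def_y -catA.
- have def_w' : w = (word_pow u r ++ u1) ++ (u2 ++ word_pow u s).
    by rewrite def_w -catA.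
  (* The letter [c] goes back right after [u1], at this position. *)
  have le_iw : size (word_pow u r ++ u1) <= size w.
    by rewrite def_w' [leqRHS]size_cat leq_addr.
  have [_] := robust _ c le_iw; apply; exists u, (r + s).+1; split=> //.
  rewrite def_w' take_size_cat // drop_size_cat // -addnS word_powD word_powS.
  (* Only the middle copy of [u], the one that regains [c], is unfolded. *)
  by rewrite {4}def_u -!catA.
Qed.
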